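(* For $n\ge 1$, $a_n(21;2\to 3)=\sum_{k=0}^{n}\binom{n}{k}f_{n-k}$, where the sequence $(f_m)_{m\ge 0}$ is defined by $f_m=B_m-\sum_{k=1}^{m}f_{k-1}B_{m-k}$ and $B_m$ is the $m$-th Bell number.
   Context: Standard cycle form of $\sigma\in S_n$: product of disjoint cycles (fixed points included), each cycle starting with its largest element, cycles listed in increasing order of largest elements. The fundamental bijection $\theta:S_n\to S_n$ erases the parentheses of the standard cycle form to give a one-line permutation. For $\pi\in S_n$, $\hat\pi=\theta^{-1}(\pi)$. An arrow pattern $(\nu;H)$ of size $k$: a string $\nu=a_1\dots a_m$ of positive integers and a set $H$ of arrows $b\to c$, with all integers appearing forming $[k]$. $\pi\in S_n$ contains $(\nu;H)$ if there is $X=\{x_1<\dots<x_k\}\subseteq[n]$ with positions $t_1<\dots<t_m$ such that $\pi_{t_1}\cdots\pi_{t_m}=x_{a_1}\cdots x_{a_m}$ and $\hat\pi(x_b)=x_c$ for every arrow $b\to c\in H$; otherwise it avoids it. $a_n(\nu;H)$ = number of $\pi\in S_n$ avoiding $(\nu;H)$. $B_m$ is the number of set partitions of $[m]$ ($B_0=1$). *)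

(* Defs.v *)
From mathcomp Require Import all_boot all_order all_algebra.
From mathcomp Require Import perm.

Set Implicit Arguments.
Unset Strict Implicit.
Unset Printing Implicit Defensive.

(* S_n is 'S_n, acting on {0, ..., n-1} instead of {1, ..., n}; the one-line
   word of pi is pi 0, pi 1, ..., pi (n-1).  Only the relative order of values
   and positions matters below. *)

Section FundamentalBijection.

Variable n : nat.
Implicit Types s t pi : 'S_n.

Definition cycle_max s (i : 'I_n) : bool := all (fun j : 'I_n => j <= i) (orbit s i).

(* [orbit s i] is [:: i; s i; s (s i); ...], and [enum 'I_n] is increasing. *)
Definition standard_cycle_form s : seq (seq 'I_n) :=
  [seq orbit s i | i <- enum 'I_n & cycle_max s i].

Definition theta_word s : seq 'I_n := flatten (standard_cycle_form s).

Lemma mem_orbit_sym s i j : (i \in orbit s j) = (j \in orbit s i).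
Proof. by rewrite -!fconnect_orbit fconnect_sym //; apply: perm_inj. Qed.

Lemma mem_orbit_trans s i j k :
  i \in orbit s j -> j \in orbit s k -> i \in orbit s k.
Proof. by rewrite -!fconnect_orbit => ij jk; apply: connect_trans jk ij. Qed.

Lemma theta_word_uniq s : uniq (theta_word s).
Proof.
rewrite /theta_word /standard_cycle_form.
have: uniq [seq i <- enum 'I_n | cycle_max s i] by rewrite filter_uniq ?enum_uniq.
have: all (cycle_max s) [seq i <- enum 'I_n | cycle_max s i] by apply: filter_all.
elim: [seq i <- _ | _] => //= a l IHl /andP[am lm] /andP[al lu].
rewrite cat_uniq orbit_uniq IHl // andbT /=.
apply/hasPn => j /flatten_mapP[b bl jb]; apply: contra al => ja.
have ab : a \in orbit s b by apply: mem_orbit_trans jb; rewrite mem_orbit_sym.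
have ba : b \in orbit s a by rewrite mem_orbit_sym.
suff -> : a = b by [].
apply/val_inj/eqP; rewrite eqn_leq (allP (allP lm _ bl)) //=.
exact: (allP am).
Qed.

Lemma mem_theta_word s j : j \in theta_word s.
Proof.
have jj : j \in orbit s j by rewrite -fconnect_orbit connect0.
case: (@arg_maxnP _ j (mem (orbit s j)) val jj) => i ij imax.
apply/flatten_mapP; exists i; last by rewrite mem_orbit_sym.
rewrite mem_filter mem_enum andbT; apply/allP => k ki; apply: imax.
exact: mem_orbit_trans ki ij.
Qed.

Lemma size_theta_word s : size (theta_word s) = n.
Proof.
rewrite -[RHS]card_ord cardE; apply/perm_size/uniq_perm.
- exact: theta_word_uniq.
- exact: enum_uniq.
- by move=> i; rewrite mem_theta_word mem_enum.
Qed.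

Definition theta_fun s (i : 'I_n) : 'I_n := nth i (theta_word s) i.

Lemma theta_fun_inj s : injective (theta_fun s).
Proof.
move=> i j; rewrite /theta_fun (set_nth_default i j) ?size_theta_word //.
by move/eqP; rewrite nth_uniq ?size_theta_word ?theta_word_uniq // => /eqP/val_inj.
Qed.

Definition theta s : 'S_n := perm (@theta_fun_inj s).

Let max_head (c : seq 'I_n) : bool :=
  if c is h :: c' then all (fun j : 'I_n => j <= h) c' else false.

Let lt_head (c d : seq 'I_n) : bool :=
  if (c, d) is (h :: _, k :: _) then h < k else false.

Lemma flatten_heads_inj (l1 l2 : seq (seq 'I_n)) :
  all max_head l1 -> all max_head l2 -> pairwise lt_head l1 ->
  pairwise lt_head l2 -> flatten l1 = flatten l2 -> l1 = l2.
Proof.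
elim: l1 l2 => [|c l1 IH] [|d l2] //=.
- by case: d => //.
- by case: c => //.
case: c => // h c; case: d => // k d /=.
move=> /andP[hc ok1] /andP[kd ok2] /andP[hl1 inc1] /andP[kl2 inc2] [ehk].
move: kd kl2; rewrite -ehk => hd hl2 {ehk k} e.
suff ecd : c = d.
  by move: e; rewrite ecd => /(congr1 (drop (size d))); rewrite !drop_size_cat // => /IH->.
have {}hl1 : all (lt_head [:: h]) l1 := hl1.
have {}hl2 : all (lt_head [:: h]) l2 := hl2.
elim: c d hc hd e => [|x c IHc] [|y d] //=.
- move=> _ /andP[yh _]; case: l1 ok1 hl1 {IH inc1} => //= -[//|z l] l1.
  by move=> _ /andP[hz _] /= [ezy]; move: hz; rewrite ezy /lt_head ltnNge yh.
- move=> /andP[yh _] _; case: l2 ok2 hl2 {inc2 IHc} => //= -[//|z l] l2.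
  by move=> _ /andP[hz _] /= [ezy]; move: hz; rewrite -ezy /lt_head ltnNge yh.
by move=> /andP[_ hc] /andP[_ hd] [-> e]; rewrite (IHc d).
Qed.

Lemma standard_cycle_form_inj : injective standard_cycle_form.
Proof.
move=> s t e; apply/permP => x.
have /flattenP[c cs xc] := mem_theta_word s x.
have ct : c \in standard_cycle_form t by rewrite -e.
have aux (u : 'S_n) : c \in standard_cycle_form u -> next c x = u x.
  case/mapP=> i _ ec; move: xc; rewrite ec => xi.
  by have /eqP := next_cycle (cycle_orbit (@perm_inj _ u) i) xi.
by rewrite -(aux s cs) (aux t ct).
Qed.

Lemma orbit_cons s i : orbit s i = i :: behead (orbit s i).
Proof. by rewrite /orbit -orderSpred. Qed.

Lemma theta_word_inj : injective theta_word.
Proof.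
have ok u : all max_head (standard_cycle_form u).
  rewrite /standard_cycle_form all_map; apply/allP => i; rewrite mem_filter.
  by case/andP; rewrite /cycle_max /= orbit_cons /= => /andP[].
have inc u : pairwise lt_head (standard_cycle_form u).
  rewrite /standard_cycle_form pairwise_map.
  have: pairwise (relpre val ltn) [seq i <- enum 'I_n | cycle_max u i].
    apply: pairwise_filter.
    by rewrite -pairwise_map val_enum_ord -sorted_pairwise ?iota_ltn_sorted //; apply: ltn_trans.
  by apply: sub_pairwise => i j /=; rewrite (orbit_cons u i) (orbit_cons u j).
by move=> s t e; apply/standard_cycle_form_inj/flatten_heads_inj.
Qed.

Lemma theta_inj : injective theta.
Proof.
move=> s t e; apply: theta_word_inj.
case: (posnP n) => [n0 | n_gt0].
  by rewrite (size0nil (etrans (size_theta_word s) n0))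
             (size0nil (etrans (size_theta_word t) n0)).
apply: (@eq_from_nth _ (Ordinal n_gt0)); rewrite !size_theta_word // => i lt_in.
have := congr1 (fun u : 'S_n => u (Ordinal lt_in)) e; rewrite !permE /theta_fun /=.
by rewrite !(set_nth_default (Ordinal n_gt0)) ?size_theta_word.
Qed.

(* The inverse of theta, which is bijective since 'S_n is finite. *)
Definition hat pi : 'S_n := invF theta_inj pi.

End FundamentalBijection.

(* The letters are 1-based, as in (21; 2 -> 3); the set of arrows is given
   by a list. *)
Record arrow_pattern := ArrowPattern {
  ap_size : nat;
  ap_string : seq nat;
  ap_arrows : seq (nat * nat);
  _ : ap_string ++ unzip1 ap_arrows ++ unzip2 ap_arrows =i iota 1 ap_size
}.

(* X lists x_1 < ... < x_k and t lists the positions t_1 < ... < t_m; the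
   letter a stands for x_a, which is [onth X a.-1] as lists are 0-based (this
   is never None, by the last field of [arrow_pattern]). *)
Definition ap_contains n (pi : 'S_n) (p : arrow_pattern) : bool :=
  [exists X : (ap_size p).-tuple 'I_n,
   exists t : (size (ap_string p)).-tuple 'I_n,
    let x a := onth X a.-1 in
    [&& sorted ltn (map val X), sorted ltn (map val t),
        [seq Some (pi i) | i <- t] == [seq x a | a <- ap_string p]
      & all (fun bc => omap (hat pi) (x bc.1) == x bc.2) (ap_arrows p)]].

Definition avoiders (p : arrow_pattern) (n : nat) : nat :=
  #|[set pi : 'S_n | ~~ ap_contains pi p]|.

Fact p21_2to3_wf : [:: 2; 1] ++ unzip1 [:: (2, 3)] ++ unzip2 [:: (2, 3)] =i iota 1 3.
Proof. by move=> a; rewrite !inE; case: (a == 1); case: (a == 2); case: (a == 3). Qed.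

Definition p21_2to3 : arrow_pattern := ArrowPattern p21_2to3_wf.

Definition bell (m : nat) : nat :=
  #|[set P : {set {set 'I_m}} | partition P [set: 'I_m]]|.

(* Main.v *)
Require Import Defs.
From HB Require Import structures.
From mathcomp Require Import all_boot all_order all_algebra.
From mathcomp Require Import perm zify ring.

(* Cutting the word of pi at its left-to-right maxima recovers the cycles of
   hat pi, so an occurrence of (21; 2 -> 3) in pi amounts to a letter x which
   is not a left-to-right maximum, is followed by a larger letter, and has a
   smaller letter further on.  Hence, reading an avoider from left to right,
   each letter is a new maximum, or the smallest unused letter, or is followed
   by a smaller one.

   Let L : Z[X] -> Z be the linear form X^n |-> B_n, so that
   L(X p(X)) = L(p(X + 1)) by the recursion for B_(n+1).  When p of the
   remaining letters lie below the current maximum and q above, the number of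
   ways to complete the word is L(X^p Q_q(X + 1)), where Q_0 = 1 and
   Q_(q+1) = X Q_q - h_q, for any sequence h with
   sum_j h_(n-j) B_j = B_(n+1); in particular a_n = L(Q_n(X + 1)) = h_n.
   Finally h_n = sum_k C(n, k) f_(n-k) satisfies this convolution identity. *)

Set Implicit Arguments.
Unset Strict Implicit.
Unset Printing Implicit Defensive.

Import Order.TTheory GRing.Theory Num.Theory.

(** * Set partitions and the recursion for Bell numbers *)

(** A partition of [A] is determined by the complement [D] of the block of [x] and by a partition of
    [D]; here [D] is any subset of [A :\ x], and ['C(m, k)] of these have [k] elements. *)
Lemma card_partition_step (T : finType) (A : {set T}) (m : nat) (x : T) :
  x \in A -> #|A| = m.+1 ->
  (forall A' : {set T}, (#|A'| <= m)%N -> #|[set P | partition P A']| = bell #|A'|) ->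
  #|[set P | partition P A]| = (\sum_(k < m.+1) 'C(m, k) * bell k)%N.
Proof.
move=> xA cA IH.
have block_x P : partition P A -> pblock P x \in P /\ x \in pblock P x.
  by move=> PA; rewrite mem_pblock pblock_mem (cover_partition PA).
have cAx : #|A :\ x| = m by have := cardsD1 x A; rewrite xA cA => -[].
rewrite -sum1_card.
rewrite (partition_big (fun P : {set {set T}} => A :\: pblock P x)
           (mem (powerset (A :\ x)))) /=; last first.
  move=> P; rewrite inE => PA; have [_ xb] := block_x P PA; rewrite powersetE.
  by apply: setDS; rewrite sub1set.
transitivity (\sum_(D in powerset (A :\ x)) bell #|D|)%N.
  apply: eq_bigr => D; rewrite powersetE => DA.
  have DA' : D \subset A by apply: subset_trans DA (subsetDl _ _).
  have xD : x \notin D by apply/negP => /(subsetP DA); rewrite !inE eqxx.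
  have xDA : x \in A :\: D by rewrite inE xD.
  rewrite -IH; last by rewrite -cAx subset_leq_card.
  rewrite sum1dep_card.
  (* Adjoining the block [A :\: D] maps the partitions of [D] injectively onto the partitions of [A]
     counted under [D]. *)
  rewrite -(card_in_imset (f := fun P => (A :\: D) |: P) (D := mem [set P | partition P D])).
    congr #|pred_of_set _|; apply/setP => P; rewrite !inE; apply/andP/imsetP.
      case=> PA /eqP eD; have [bP xb] := block_x P PA.
      have eb : A :\: D = pblock P x.
        rewrite -eD setDDr setDv set0U; apply/setIidPr.
        by rewrite -(cover_partition PA); apply: (bigcup_sup (pblock P x)).
      exists (P :\ (A :\: D)); last by rewrite setD1K ?eb.
      by rewrite inE -[X in partition _ X]eD eb; apply: partitionD1.
    case=> P'; rewrite inE => PD ->.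
    have PA : partition ((A :\: D) |: P') A.
      have {2}-> : A = (A :\: D) :|: D.
        apply/setP => y; rewrite !inE.
        by case: (boolP (y \in D)) => [/(subsetP DA')->|_]; rewrite ?orbT ?orbF.
      apply: partitionU1 => //; first by apply/set0Pn; exists x.
      by rewrite -setI_eq0 setIDAC setDIl setDv setI0.
    split=> //; apply/eqP.
    rewrite (def_pblock (B := A :\: D)) ?inE ?eqxx ?xD //.
      by rewrite setDDr setDv set0U; apply/setIidPr.
    by case/and3P: PA.
  move=> P1 P2; rewrite !inE => p1 p2 e.
  have nin P : partition P D -> A :\: D \notin P.
    move=> pP; apply: contra xD => iP; rewrite -(cover_partition pP).
    by apply/bigcupP; exists (A :\: D).
  by rewrite -(setU1K (nin _ p1)) e setU1K ?nin.
(* The sets [D] are grouped by size; [inord] loses nothing because [D] has at most [m] elements. *)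
rewrite (partition_big (fun D : {set T} => inord #|D|) (mem 'I_m.+1)) //=.
apply: eq_bigr => k _.
rewrite (eq_bigl (fun D : {set T} => (D \subset A :\ x) && (#|D| == k))); last first.
  move=> D; rewrite powersetE; case DA: (D \subset _) => //=.
  have := subset_leq_card DA; rewrite cAx -ltnS => lt.
  by rewrite -val_eqE /= inordK.
rewrite (eq_bigr (fun _ => bell k)); last by move=> D /andP[_ /eqP->].
rewrite sum_nat_cond_const; have := cards_draws (A :\ x) k; rewrite cAx => <-.
by congr (_ * _)%N.
Qed.

(** Strong induction on the size of [A], uniform in [T]: the step lemma gives the same sum for [A]
    and for the full set of ordinals that defines [bell]. *)
Lemma card_partition (T : finType) (A : {set T}) :
  #|[set P | partition P A]| = bell #|A|.
Proof.
have [m le_m] := ubnP #|A|; elim: m => // m IH in T A le_m *.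
have [c0|] := posnP #|A|.
  have part0 (U : finType) : #|[set P | partition P (set0 : {set U})]| = 1%N.
    rewrite -[RHS](cards1 (set0 : {set {set U}})); congr #|pred_of_set _|.
    by apply/setP => P; rewrite !inE partition_set0.
  rewrite c0 (cards0_eq c0) part0 /bell.
  have -> : [set: 'I_0] = set0 by apply/setP => -[].
  by rewrite part0.
case cA: #|A| => [//|k] _.
have /card_gt0P[x xA] : (0 < #|A|)%N by rewrite cA.
rewrite (card_partition_step xA cA); last first.
  by move=> A' le_A'k; apply: IH; apply: leq_ltn_trans le_A'k _; rewrite -cA.
rewrite /bell (@card_partition_step _ _ k ord0) ?inE ?cardsT ?card_ord //.
by move=> A' le_A'k; apply: IH; apply: leq_ltn_trans le_A'k _; rewrite -cA.
Qed.

Lemma bellS n : bell n.+1 = (\sum_(k < n.+1) 'C(n, k) * bell k)%N.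
Proof.
rewrite /bell (@card_partition_step _ _ n ord0) ?inE ?cardsT ?card_ord // => A' _.
exact: card_partition.
Qed.

Lemma bell0 : bell 0 = 1%N.
Proof.
rewrite /bell -[RHS](cards1 (set0 : {set {set 'I_0}})); congr #|pred_of_set _|.
have -> : [set: 'I_0] = set0 by apply/setP => -[].
by apply/setP => P; rewrite !inE partition_set0.
Qed.

(** * Pattern containment read off the one-line word *)

(* M is a strict upper bound of the letters read before w, so that x < M means
   that x is not a left-to-right maximum. *)
Fixpoint avoiding (M : nat) (w : seq nat) : bool :=
  if w is x :: w' then
    (if w' is y :: w'' then (x < M)%N ==> (x < y)%N ==> all (ltn x) w'' else true)
    && avoiding (maxn M x) w'
  else true.

(** The condition on [s1] accounts for the growth of [M]: when [x] is reached, the running bound is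
    the larger of [M] and the letters of [s1]. *)
Lemma avoidingPn M w :
  reflect (exists s1 x y s2, [/\ w = s1 ++ x :: y :: s2, (x < M) || has (ltn x) s1,
             x < y & ~~ all (ltn x) s2])
          (~~ avoiding M w).
Proof.
elim: w M => [|a w IH] M; first by constructor=> -[[|? ?]] [? [? [? []]]].
rewrite [avoiding _ _]/= negb_and; apply: (iffP orP).
  case=> [|/IH[s1 [x [y [s2 [-> xM xy nall]]]]]].
    case: w {IH} => // y w; rewrite !negb_imply => /and3P[aM ay nall].
    by exists [::], a, y, w; rewrite aM.
  by exists (a :: s1), x, y, s2; rewrite /= orbA -leq_max.
move=> [[|b s1] [x [y [s2 [[-> ew] xM xy nall]]]]]; rewrite ew in IH *.
  by left; rewrite /= orbF in xM; rewrite xM xy.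
by right; apply/IH; exists s1, x, y, s2; rewrite leq_max -orbA.
Qed.

(** After rotating [x] to the front, its successor is the head of [v]; if [v] is empty it wraps
    around to the head of [u], and to [x] itself on a cycle of length 1. *)
Lemma fcycle_split (T : eqType) (f : T -> T) u x v :
  fcycle f (u ++ x :: v) -> f x = head (head x u) v.
Proof.
rewrite -(rot_cycle (size u)) rot_size_cat /=.
by case: v u => [|z v] [|a u] //= /andP[/eqP].
Qed.

Section Words.
Variable n : nat.
Implicit Types pi : 'S_n.

(** The factor [u ++ x :: v] is the cycle of [x], with maximum [head x u]; [A] and [C] are the
    earlier and later cycles. Cycle maxima increase, so [A] lies below this maximum, while
    [take 1 C] holds the next cycle maximum, if there is one. *)
Lemma theta_word_split (s : 'S_n) (x : 'I_n) : exists A u v C,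
  [/\ theta_word s = A ++ (u ++ x :: v) ++ C, s x = head (head x u) v,
      all (fun y : 'I_n => y < head x u) A,
      all (fun y : 'I_n => y <= head x u) (u ++ x :: v) &
      all (fun y : 'I_n => head x u < y) (take 1 C)].
Proof.
have /flatten_mapP[i] := mem_theta_word s x.
rewrite /theta_word /standard_cycle_form.
set l := filter _ _ => il xi.
have sl : sorted ltn (map val l).
  apply: (@subseq_sorted _ _ ltn_trans _ (map val (enum 'I_n))).
    by apply: map_subseq; apply: filter_subseq.
  by rewrite val_enum_ord iota_ltn_sorted.
have lmax : all (cycle_max s) l by apply: filter_all.
have cyc := cycle_orbit (@perm_inj _ s) i.
have ei := orbit_cons s i.
case/splitPr: il sl lmax => A C; rewrite map_cat /= sorted_pairwise; last exact: ltn_trans.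
rewrite pairwise_cat /= all_cat => /and4P[lA _ lC _] /and3P[mA mi _].
have [u [v eo]] : exists u v, orbit s i = u ++ x :: v.
  by case/splitPr: xi => u v; exists u, v.
rewrite /cycle_max eo in cyc ei mi.
have hi : head x u = i by case: u ei {cyc mi eo} => [|a u] [].
exists (flatten (map (orbit s) A)), u, v, (flatten (map (orbit s) C)).
rewrite hi; split=> //.
- by rewrite map_cat flatten_cat /= eo.
- by rewrite (fcycle_split cyc) hi.
- apply/allP => y /flatten_mapP[k kA yk].
  apply: (@leq_ltn_trans k); first exact: (allP (allP mA _ kA)).
  by apply: (allrelP lA); [apply: map_f | apply: mem_head].
case: C lC {lA} => //= k C /andP[ik _].
by rewrite (orbit_cons s k) /= take0 ik.
Qed.

(** Inside a cycle the letter after [x] is [s x]. If [x] ends its cycle, then [s x] is the cycle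
    maximum and the next letter, if any, is an even larger maximum. So for an [x] that is not a
    left-to-right maximum and is not the last letter, [x < s x] holds exactly when the next letter
    exceeds [x]. *)
Lemma excedance_before_smaller_iff (s : 'S_n) :
  (exists s1 x s2 y, [/\ theta_word s = s1 ++ x :: s2, x < s x, y \in s2 & y < x])
  <-> ~~ avoiding 0 (map val (theta_word s)).
Proof.
have uw := theta_word_uniq s.
have pivot s1 s2 A x u v C : theta_word s = s1 ++ x :: s2 ->
    theta_word s = A ++ (u ++ x :: v) ++ C -> s1 = A ++ u /\ s2 = v ++ C.
  move=> e1 e2; have : x \notin s1 /\ x \notin s2.
    move: uw; rewrite e1 cat_uniq /= => /and3P[_ + /andP[-> _]].
    by rewrite negb_or => /andP[-> _].
  case=> x1 x2; have /eqP := e2; rewrite e1 -catA catA /= eqseq_pivotl //.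
  by case/andP=> /eqP -> /eqP ->.
split=> [[s1 [x [s2 [y [e xsx ys2 yx]]]]] | /avoidingPn[a1 [a [b [a2 [e a1a ab na]]]]]].
  have [A [u [v [C [e' sxE _ maxc C1]]]]] := theta_word_split s x.
  have [e1 e2] := pivot _ _ _ _ _ _ _ e e'.
  (* The letter right after [x] exceeds [x], so [y] must come further on. *)
  have nall z t : y \in z :: t -> x < z -> ~~ all (ltn (val x)) (map val t).
    rewrite inE => /orP[/eqP <- /ltnW|yt _]; first by rewrite leqNgt yx.
    by apply/allPn; exists (val y); rewrite ?map_f //= -leqNgt ltnW.
  have hx : x < head x u -> has (ltn (val x)) (map val s1).
    rewrite e1 map_cat has_cat; case: u {sxE maxc C1 e' e1} => [|h u] /=; first by rewrite ltnn.
    by move=> ->; rewrite orbT.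
  apply/avoidingPn; exists (map val s1), (val x).
  case: v sxE maxc e' e2 => [|z v] /= sxE maxc _ e2; last first.
    exists (val z), (map val (v ++ C)); rewrite e e2 map_cat /=; split => //.
    - apply: hx; apply: leq_trans (_ : z <= _); first by rewrite -sxE.
      by apply: (allP maxc); rewrite mem_cat !inE eqxx !orbT.
    - by rewrite -sxE.
    - by apply: (nall z (v ++ C)); [rewrite -e2 | rewrite -sxE].
  rewrite sxE in xsx; case: C C1 e2 => [|z C] /= C1 e2; first by rewrite e2 in ys2.
  have xz : x < z by apply: ltn_trans xsx _; case/andP: C1.
  exists (val z), (map val C); rewrite e e2 map_cat /=; split => //.
    exact: hx.
  by apply: nall xz; rewrite -e2.
have [t1 [x [z [t2 [ew e1 ex ez e2]]]]] : exists t1 x z t2,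
    [/\ theta_word s = t1 ++ x :: z :: t2, map val t1 = a1, val x = a, val z = b & map val t2 = a2].
  move: (theta_word s) e => w e; exists (take (size a1) w).
  have := congr1 (take (size a1)) e; rewrite -map_take take_size_cat // => e1.
  have := congr1 (drop (size a1)) e; rewrite -map_drop drop_size_cat //.
  case ed: (drop _ _) => [|x [|z t2]] //= -[ex ez e2].
  by exists x, z, t2; rewrite -ed cat_take_drop.
have [A [u [v [C [e' sxE Alt maxc C1]]]]] := theta_word_split s x.
have [e1' e2'] := pivot _ _ _ _ _ _ _ ew e'.
move: na; rewrite -e2 all_map => /allPn[y yt2 /=]; rewrite -ex -leqNgt => le_yx.
exists t1, x, (z :: t2), y; split => //; last first.
- rewrite ltn_neqAle le_yx andbT; apply: contraTneq uw => eyx.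
  rewrite ew cat_uniq /= !inE -(val_inj eyx) yt2 orbT /=.
  by rewrite !andbF.
- by rewrite inE yt2 orbT.
rewrite sxE; case: v {sxE} maxc e' e2' => [|z' v] maxc e' e2' /=; last first.
  by case: e2' => <- _; rewrite ex ez.
(* Here [x] ends its cycle and [s x] is the cycle maximum, which bounds every earlier letter, in
   particular one exceeding [x]. *)
move: a1a; rewrite -e1 has_map e1' => /= /hasP[h]; rewrite /= -ex mem_cat => /orP[hA | hu] xh.
  exact: ltn_trans xh (allP Alt _ hA).
by apply: leq_trans xh (allP maxc _ _); rewrite mem_cat hu.
Qed.

Definition one_line pi : seq nat := [seq val (pi i) | i <- enum 'I_n].

Lemma theta_word_hat pi : theta_word (hat pi) = [seq pi i | i <- enum 'I_n].
Proof.
have {2}<- : theta (hat pi) = pi by apply: f_invF.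
have sz : size (theta_word (hat pi)) = n by apply: size_theta_word.
case: (posnP n) => [n0 | n_gt0].
  by rewrite (size0nil (etrans sz n0)); apply/esym/size0nil; rewrite size_map size_enum_ord.
apply: (@eq_from_nth _ (Ordinal n_gt0)); first by rewrite sz size_map size_enum_ord.
rewrite sz => i lt_in.
rewrite (nth_map (Ordinal n_gt0)) ?size_enum_ord // permE /theta_fun.
have -> : nth (Ordinal n_gt0) (enum 'I_n) i = Ordinal lt_in.
  by apply: val_inj; rewrite /= nth_enum_ord.
by apply: set_nth_default; rewrite sz.
Qed.

Lemma sorted_enum : pairwise (fun i j : 'I_n => i < j) (enum 'I_n).
Proof.
rewrite -(pairwise_map (fun i : 'I_n => val i) ltn) val_enum_ord.
by rewrite -sorted_pairwise ?iota_ltn_sorted //; apply: ltn_trans.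
Qed.

(** In an occurrence, x_2 is the excedance [x], x_3 is its image under [hat pi], and x_1 is the
    smaller letter [y] to the right of [x]. *)
Lemma ap_contains_one_line pi : ap_contains pi p21_2to3 = ~~ avoiding 0 (one_line pi).
Proof.
have -> : one_line pi = map val (theta_word (hat pi)) by rewrite theta_word_hat -map_comp.
apply/idP/idP => [/existsP[X /existsP[t /and4P[]]] | ].
  case: X => -[|x1 [|x2 [|x3 [|]]]] // Xsz; case: t => -[|t1 [|t2 []]] //= tsz.
  move=> /and3P[x12 x23 _] /andP[t12 _] /eqP[e1 e2] /andP[/eqP[e3] _].
  apply/excedance_before_smaller_iff.
  have t1e : t1 \in enum 'I_n by rewrite mem_enum.
  have t2e : t2 \in enum 'I_n by rewrite mem_enum.
  move: sorted_enum t2e; rewrite theta_word_hat.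
  case/splitPr: t1e => p1 p2; rewrite pairwise_cat allrel_consr /=.
  case/and3P=> /andP[p1t1 _] _ _; rewrite mem_cat inE => t2p.
  exists (map pi p1), x2, (map pi p2), x1; rewrite map_cat /= e1 e3 -e2; split=> //.
    apply: map_f; case/or3P: t2p => // [/(allP p1t1) /= | /eqP t2t1].
      by rewrite ltnNge ltnW.
    by rewrite t2t1 ltnn in t12.
  by rewrite e2.
case/excedance_before_smaller_iff => s1 [x [s2 [y [e xsx ys2 yx]]]].
have [p1 [t1 [p2 [ee _ et1 e2]]]] : exists p1 t1 p2,
    [/\ enum 'I_n = p1 ++ t1 :: p2, map pi p1 = s1, pi t1 = x & map pi p2 = s2].
  move: e; rewrite theta_word_hat => e; exists (take (size s1) (enum 'I_n)).
  have := congr1 (take (size s1)) e; rewrite -map_take take_size_cat // => e1.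
  have := congr1 (drop (size s1)) e; rewrite -map_drop drop_size_cat //.
  case ed: (drop _ _) => [|t1 p2] //= -[et ep].
  by exists t1, p2; rewrite -ed cat_take_drop.
move: ys2; rewrite -e2 => /mapP[t2 t2p2 et2].
have t12 : t1 < t2.
  move: sorted_enum; rewrite ee pairwise_cat /= => /and4P[_ _ /allP lt _].
  exact: lt.
apply/existsP; exists [tuple y; x; hat pi x]; apply/existsP; exists [tuple t1; t2].
by rewrite /= yx xsx t12 et1 et2 !eqxx.
Qed.

(** * From permutations to words, and ranks in increasing lists *)

(** One-line words are pairwise distinct rearrangements of [iota 0 n], and there are n! of them, so
    they are all the rearrangements. *)
Lemma perm_one_line :
  perm_eq (map one_line (index_enum {perm 'I_n})) (permutations (iota 0 n)).
Proof.
have inj : injective one_line.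
  move=> p1 p2 e; apply/permP => i; apply/val_inj.
  have /eq_in_map := e; apply; exact: mem_enum.
have u1 : uniq (map one_line (index_enum {perm 'I_n})).
  by rewrite map_inj_uniq // index_enum_uniq.
have sub : {subset map one_line (index_enum {perm 'I_n}) <= permutations (iota 0 n)}.
  move=> _ /mapP[pi _ ->]; rewrite mem_permutations -val_enum_ord /one_line.
  rewrite (map_comp val pi); apply/perm_map/uniq_perm.
  - by rewrite map_inj_uniq ?enum_uniq //; apply: perm_inj.
  - exact: enum_uniq.
  - move=> i; rewrite mem_enum -(permKV pi i); apply: map_f; exact: mem_enum.
have [] := uniq_min_size u1 sub.
  rewrite size_permutations ?iota_uniq // size_iota size_map -card_Sn.
  by rewrite cardT enumT [index_enum _]unlock.
by move=> _ eqi; apply: uniq_perm => //; apply: permutations_uniq.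
Qed.

Lemma avoiders_count :
  avoiders p21_2to3 n = count (avoiding 0) (permutations (iota 0 n)).
Proof.
rewrite -(seq.permP perm_one_line) count_map -sum1_count /avoiders -sum1dep_card.
by apply: eq_bigl => pi /=; rewrite ap_contains_one_line negbK.
Qed.

End Words.

Lemma count_permutations_cons (a : pred (seq nat)) (s : seq nat) :
  uniq s -> (0 < size s)%N ->
  count a (permutations s) =
  (\sum_(i < size s) count (fun t => a (nth 0%N s i :: t)) (permutations (rem (nth 0%N s i) s)))%N.
Proof.
move=> us s_gt0; rewrite (seq.permP (permutationsE s_gt0)) undup_id // count_flatten.
rewrite sumnE !big_map (big_nth 0%N) big_mkord; apply: eq_bigr => i _.
by rewrite count_map.
Qed.

(** The entries below [M] form an initial segment of an increasing list. *)
Lemma nth_lt_count (s : seq nat) (M i : nat) : sorted ltn s -> (i < size s)%N ->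
  (nth 0%N s i < M)%N = (i < count (fun y => y < M) s)%N.
Proof.
elim: s i => [|a s IH] i //= pas; have ss := path_sorted pas.
have /allP as_ : all (ltn a) s by move: pas; rewrite path_sortedE; [case/andP | apply: ltn_trans].
case: (ltnP a M) => [aM | Ma].
  by case: i => [|i] // lt_is; rewrite add1n ltnS -IH.
have -> : count (fun y => y < M)%N s = 0%N.
  by apply/eqP; rewrite -leqn0 leqNgt -has_count; apply/hasPn => y /as_ /=; lia.
case: i => [|i] /= lt_is; first by lia.
by have := as_ _ (mem_nth 0%N lt_is); rewrite /=; lia.
Qed.

Lemma count_lt_nth (s : seq nat) (i : nat) : sorted ltn s -> (i < size s)%N ->
  count (fun y => y < nth 0%N s i)%N s = i.
Proof.
move=> ss lt_is; have := nth_lt_count (nth 0%N s i) ss lt_is.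
set c := count _ _; rewrite ltnn => /esym/negbT; rewrite -leqNgt => le_ci.
apply/eqP; rewrite eqn_leq le_ci leqNgt; apply/negP => lt_ci.
have := nth_lt_count (nth 0%N s i) ss (ltn_trans lt_ci lt_is).
by rewrite -/c ltnn (sorted_ltn_nth ltn_trans) ?inE // (ltn_trans lt_ci).
Qed.

(** * The linear form sending X^n to the n-th Bell number *)

Local Open Scope ring_scope.

Lemma Posz_sum I (r : seq I) (P : pred I) (F : I -> nat) :
  (\sum_(i <- r | P i) F i)%N%:Z = \sum_(i <- r | P i) (F i)%:Z.
Proof. exact: (big_morph Posz PoszD (erefl _)). Qed.

Definition bell_umbra (p : {poly int}) : int := \sum_(i < size p) p`_i * (bell i)%:Z.

Lemma bell_umbra_widen N (p : {poly int}) : (size p <= N)%N ->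
  bell_umbra p = \sum_(i < N) p`_i * (bell i)%:Z.
Proof.
move=> leN; rewrite /bell_umbra (big_ord_widen N (fun i => p`_i * (bell i)%:Z)) //.
rewrite big_mkcond; apply: eq_bigr => i _; case: ltnP => // le_i.
by rewrite nth_default // mul0r.
Qed.

Lemma bell_umbra_is_scalar : scalar bell_umbra.
Proof.
move=> c p q; pose N := maxn (size p) (size q).
rewrite !(@bell_umbra_widen N) ?leq_maxl ?leq_maxr //; last first.
  apply: leq_trans (size_polyD _ _) _.
  by rewrite geq_max leq_maxr andbT (leq_trans (size_scale_leq _ _)) ?leq_maxl.
rewrite mulr_sumr -big_split /=; apply: eq_bigr => i _.
by rewrite coefD coefZ mulrDl mulrA.
Qed.

HB.instance Definition _ :=
  GRing.isLinear.Build int {poly int} int *%R bell_umbra bell_umbra_is_scalar.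

Lemma bell_umbraXn n : bell_umbra 'X^n = (bell n)%:Z.
Proof.
rewrite /bell_umbra size_polyXn big_ord_recr /= coefXn eqxx mul1r big1 ?add0r //.
by move=> i _; rewrite coefXn ltn_eqF ?mul0r.
Qed.

(** By linearity it suffices to treat monomials, where expanding (X + 1)^i turns the claim into the
    recursion for B_(i+1). *)
Lemma bell_umbra_shift p : bell_umbra ('X * p) = bell_umbra (p \Po ('X + 1)).
Proof.
rewrite -[p]coefK poly_def mulr_sumr !linear_sum /=; apply: eq_bigr => i _.
rewrite linearZ /= -scalerAr !linearZ /= -exprS bell_umbraXn comp_Xn_poly.
congr (_ * _); rewrite addrC exprDn linear_sum bellS /= Posz_sum.
apply: eq_bigr => k _; rewrite expr1n mul1r raddfMn /= bell_umbraXn.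
by rewrite PoszM mulrC -mulr_natr natz.
Qed.

(** * The polynomials Q_q and their values under L *)

Section Recursion.
Variable h : nat -> int.

(* Q_q in the header, and [deconv1 q] is Q_q(X + 1). *)
Fixpoint deconv (q : nat) : {poly int} :=
  if q is q'.+1 then 'X * deconv q' - (h q')%:P else 1.

Definition deconv1 q := deconv q \Po ('X + 1).

Lemma deconv1S q : deconv1 q.+1 = ('X + 1) * deconv1 q - (h q)%:P.
Proof. by rewrite /deconv1 /= comp_polyB comp_polyM comp_polyX comp_polyC. Qed.

(** Subtracting the two recursions cancels h_q and leaves (X + 1) Q_q(X + 1) - X Q_q = Q_q(X + 1) +
    X (Q_q(X + 1) - Q_q). The sum collects the choices of a new maximum: taking the i-th available
    one, counted from 0, moves [i] letters below the maximum. *)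
Lemma sum_deconv1 q :
  \sum_(i < q) 'X^i * deconv1 (q.-1 - i) = deconv1 q - deconv q.
Proof.
elim: q => [|q IH]; first by rewrite big_ord0 /deconv1 /= comp_polyC subrr.
rewrite big_ord_recl /= subn0 expr0 mul1r.
transitivity (deconv1 q + 'X * (deconv1 q - deconv q)).
  rewrite -IH mulr_sumr; congr (_ + _); apply: eq_bigr => i _.
  by rewrite /bump /= exprS mulrA; congr (_ * deconv1 _); case: i => i /=; lia.
by rewrite deconv1S; ring.
Qed.

(** Unrolling the recursion gives Q_q = X^q - sum_(j < q) h_(q-1-j) X^j. *)
Lemma bell_umbra_deconv p q : bell_umbra ('X^p * deconv q) =
  (bell (p + q))%:Z - \sum_(j < q) h (q.-1 - j) * (bell (p + j))%:Z.
Proof.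
elim: q p => [|q IH] p; first by rewrite mulr1 bell_umbraXn big_ord0 addn0 subr0.
rewrite /= mulrBr mulrA -exprSr linearB /= IH big_ord_recl /= subn0 addn0 addSnnS.
rewrite mulrC mul_polyC linearZ /= bell_umbraXn opprD addrA addrAC; congr (_ - _ - _).
by apply: eq_bigr => i _; rewrite /bump /= addSnnS; congr (h _ * _); case: i => i /=; lia.
Qed.

Hypothesis conv : forall n, \sum_(j < n.+1) h (n - j) * (bell j)%:Z = (bell n.+1)%:Z.

Lemma bell_umbra_deconv0 q : bell_umbra (deconv q) = (q == 0)%:R.
Proof.
have := bell_umbra_deconv 0 q; rewrite mul1r => ->; rewrite add0n.
case: q => [|q]; first by rewrite big_ord0 bell0 subr0.
by rewrite /= conv subrr.
Qed.

(** The shift rule turns the left side into L(X Q_q), which is B_(q+1) minus all terms of the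
    convolution except the one with B_0, namely h_q. *)
Lemma bell_umbra_deconv1 q : bell_umbra (deconv1 q) = h q.
Proof.
rewrite -bell_umbra_shift -['X]expr1 bell_umbra_deconv add1n -conv big_ord_recl.
rewrite subn0 bell0 mulr1 -addrA [X in _ + X](_ : _ = 0) ?addr0 //; apply/eqP.
rewrite subr_eq0; apply/eqP/eq_bigr => i _; rewrite add1n; congr (h _ * _).
by rewrite /= /bump; case: i => i /=; lia.
Qed.

End Recursion.

(** * The convolution identity for the binomial transform of f *)

(** Induction on [n] by Pascal's rule; for [k] = 0 the extra summand B_(n+1) is expanded by the Bell
    recursion. *)
Lemma bin_bell_conv k n :
  (\sum_(i < n.+1) 'C(i, k) * bell (n - i) =
   'C(n, k) + \sum_(m < n) 'C(n, k + m.+1) * bell m)%N.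
Proof.
elim: n k => [|n IH] k; first by rewrite big_ord0 big_ord1 bell0 muln1 addn0.
rewrite big_ord_recl /= subn0.
under eq_bigr do rewrite /bump /= add1n subSS.
case: k => [|k].
  rewrite (eq_bigr (fun i : 'I_n.+1 => 'C(i, 0) * bell (n - i))%N); last first.
    by move=> i _; rewrite !bin0.
  rewrite IH bellS !bin0 mul1n.
  have -> : (\sum_(m < n.+1) 'C(n.+1, 0 + m.+1) * bell m =
    \sum_(m < n.+1) 'C(n, m) * bell m + \sum_(m < n.+1) 'C(n, 0 + m.+1) * bell m)%N.
    rewrite -big_split /=; apply: eq_bigr => i _.
    by rewrite !add0n binS mulnDl addnC.
  rewrite [in X in _ = (_ + (_ + X))%N]big_ord_recr /= add0n bin_small // mul0n addn0; lia.
under eq_bigr do rewrite binS mulnDl.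
rewrite big_split /= !IH bin0n mul0n add0n binS addnACA; congr (_ + _)%N.
under [in RHS]eq_bigr do rewrite addSn binS mulnDl.
rewrite big_split /= !(big_ord_recr n) /= !bin_small ?mul0n ?addn0 //; lia.
Qed.

(** Exchanging sums and applying [bin_bell_conv] to the coefficient of each f_k gives sum_m C(n, m)
    (f_m + sum_(k < m) f_k B_(m-k-1)). By the definition of f the bracket is B_m, and the Bell
    recursion concludes. *)
Lemma conv_binomial_transform (f : nat -> int)
  (f_def : forall m : nat,
     f m = (bell m)%:Z - \sum_(1 <= k < m.+1) f k.-1 * (bell (m - k)%N)%:Z) n :
  \sum_(j < n.+1) (\sum_(0 <= k < (n - j).+1) ('C(n - j, k))%:Z * f (n - j - k)%N) *
    (bell j)%:Z = (bell n.+1)%:Z.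
Proof.
have bellE m : (bell m)%:Z = f m + \sum_(k < m) f k * (bell (m - k.+1))%:Z.
  by rewrite f_def big_add1 /= big_mkord subrK.
(* Binomial symmetry, then padding with vanishing coefficients, makes the range independent of [i]
   so that the sums can be exchanged. *)
have bt i : (i <= n)%N -> \sum_(0 <= k < i.+1) ('C(i, k))%:Z * f (i - k)%N =
    \sum_(k < n.+1) ('C(i, k))%:Z * f k.
  move=> le_in; rewrite big_mkord (reindex_inj rev_ord_inj) /=.
  rewrite (big_ord_widen n.+1 (fun k => ('C(i, (i.+1 - k.+1)))%:Z * f (i - (i.+1 - k.+1))%N)) //.
  rewrite big_mkcond; apply: eq_bigr => k _; case: ltnP => [lt_ki | le_ik].
    by rewrite subSS bin_sub // subKn.
  by rewrite bin_small // mul0r.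
rewrite (reindex_inj rev_ord_inj) /=.
transitivity (\sum_(i < n.+1) \sum_(k < n.+1) f k * ('C(i, k) * bell (n - i))%:Z).
  apply: eq_bigr => i _; have le_in : (i <= n)%N by rewrite -ltnS.
  rewrite subSS subKn // bt //.
  by rewrite mulr_suml; apply: eq_bigr => k _; rewrite PoszM mulrAC mulrC.
rewrite exchange_big /=.
transitivity (\sum_(k < n.+1) (f k * 'C(n, k)%:Z +
   \sum_(m < n.+1 | (k < m)%N) f k * ('C(n, m) * bell (m - k.+1))%:Z)).
  apply: eq_bigr => k _; rewrite -mulr_sumr -Posz_sum.
  rewrite bin_bell_conv PoszD mulrDr; congr (_ + _).
  rewrite -mulr_sumr; congr (_ * _); rewrite -Posz_sum; congr Posz.
  (* Substitute j = m + k + 1; the terms with j > n vanish. *)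
  pose G j := ('C(n, j) * bell (j - k.+1))%N.
  transitivity (\sum_(k.+1 <= j < n + k.+1) G j)%N.
    have := big_addn 0 (n + k.+1) k.+1 xpredT G; rewrite add0n addnK => ->; rewrite big_mkord.
    by apply: eq_bigr => m _; rewrite /G addnK [(m + _)%N]addnC addSnnS.
  rewrite (big_cat_nat (n := n.+1)) //=; last by rewrite addnS ltnS leq_addr.
  rewrite [X in (_ + X)%N]big_nat_cond [X in (_ + X)%N]big1 ?addn0; last first.
    by move=> j /andP[/andP[lt_nj _] _]; rewrite /G bin_small.
  by rewrite (big_nat_widenl k.+1 0) // big_mkord.
rewrite big_split /= (exchange_big_dep predT) //= -big_split /= bellS.
rewrite Posz_sum; apply: eq_bigr => m _.
rewrite PoszM bellE mulrDr mulrC; congr (_ + _).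
rewrite (big_ord_widen n.+1 (fun k => f k * (bell (m - k.+1))%:Z)) 1?ltnW //.
by rewrite mulr_sumr; apply: eq_bigr => k _; rewrite PoszM; ring.
Qed.

(** * Counting the completions of a word *)

(* The i-th term counts the words whose first letter is the i-th smallest
   unused letter, lying below the current maximum. *)
Lemma sum_descent_poly (p r : nat) : (0 < r <= p)%N ->
  \sum_(i < r) (if i == 0%N :> nat then 'X^(p.-1) else 'X^(p.-1 - i) * ('X + 1) ^+ i.-1)
  = 'X^(p - r) * ('X + 1) ^+ r.-1 :> {poly int}.
Proof.
case: r => // r /= lt_rp; elim: r lt_rp => [|r IH] lt_rp.
  by rewrite big_ord1 /= subn1 mulr1.
rewrite big_ord_recr /= IH 1?ltnW // (_ : p - r.+1 = (p.-1 - r.+1).+1)%N; last by lia.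
by rewrite (_ : p - r.+2 = p.-1 - r.+1)%N; [rewrite !exprS; ring | lia].
Qed.

Section Count.
Variable h : nat -> int.
Hypothesis conv : forall n, \sum_(j < n.+1) h (n - j) * (bell j)%:Z = (bell n.+1)%:Z.
Local Notation P := (deconv1 h).
Local Notation L := bell_umbra.

(** When the next letter exceeds [z], requiring the letters after it to exceed [z] is the same as
    requiring this of all remaining letters. *)
Lemma avoiding_cons_below M z s t : z \notin s -> (z < M)%N -> perm_eq t s ->
  avoiding M (z :: t) = avoiding M t && (all (ltn z) s || (head 0%N t < z)%N).
Proof.
move=> zs zM ts; have ats := perm_all (ltn z) ts; rewrite -ats.
have {ats}zt : z \notin t by rewrite (perm_mem ts).
rewrite /= (maxn_idPl (ltnW zM)) zM andbC; congr (_ && _).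
case: t zt {ts} => //= y t; rewrite inE negb_or => /andP[zy _].
by case: ltngtP zy => //= _; rewrite ?orbF ?orbT // implybT.
Qed.

Lemma count_avoiding n (s : seq nat) M : sorted ltn s -> size s = n ->
  let p := count (fun y => y < M)%N s in
  (count (avoiding M) (permutations s))%:Z = L ('X^p * P (n - p)) /\
  forall x, (x <= M)%N -> let r := count (fun y => y < x)%N s in (0 < r)%N ->
    (count (fun t => avoiding M t && (head 0%N t < x)%N) (permutations s))%:Z =
    L ('X^(p - r) * ('X + 1) ^+ r.-1 * P (n - p)).
Proof.
elim: n s M => [|n IH] s M ss sz p.
  by rewrite /p (size0nil sz) /= mul1r (_ : P 0 = 'X^0) ?bell_umbraXn ?bell0 //; exact: comp_polyC.
have us : uniq s by apply: (sorted_uniq ltn_trans ltnn).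
have le_p : (p <= n.+1)%N by rewrite -sz count_size.
set q := (n.+1 - p)%N.
pose D (i : nat) : {poly int} := if i == 0%N then 'X^(p.-1) else 'X^(p.-1 - i) * ('X + 1) ^+ i.-1.
(* Contribution of the first letter of rank [i], counted from 0: for [i < p] the maximum stays and
   [q] letters remain above it; otherwise the letter becomes the maximum, with [i] letters below it
   and [n - i] above. *)
have g i : (i < n.+1)%N ->
   (count (fun t => avoiding M (nth 0%N s i :: t)) (permutations (rem (nth 0%N s i) s)))%:Z =
   L (if (i < p)%N then D i * P q else 'X^i * P (n - i)).
  move=> lt_in; have lt_is : (i < size s)%N by rewrite sz.
  set z := nth 0%N s i; set s' := rem z s.
  have zs : z \in s by apply: mem_nth.
  have ss' : sorted ltn s' by apply: subseq_sorted ss; [apply: ltn_trans | apply: rem_subseq].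
  have sz' : size s' = n by rewrite size_rem // sz.
  have zs' : z \notin s' by rewrite mem_rem_uniqF.
  have cz : count (fun y => y < z)%N s' = i.
    by rewrite count_rem ltnn andbF subn0 count_lt_nth.
  have cM : count (fun y => y < M)%N s' = (p - (i < p))%N.
    by rewrite count_rem zs -/p; congr (p - _)%N; rewrite /z nth_lt_count.
  have zM : (z < M)%N = (i < p)%N by rewrite /z nth_lt_count.
  rewrite -zM in cM *; case: ltnP zM cM => [lt_zM /esym lt_ip | le_pi _] cM; last first.
    have [IHz _] := IH s' z ss' sz'; rewrite cz in IHz; rewrite -IHz; congr Posz.
    apply: eq_count => t /=; rewrite ltnNge le_pi /= (maxn_idPr le_pi).
    by case: t.
  have [IHa IHb] := IH s' M ss' sz'; rewrite cM in IHa IHb.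
  have eq : (n - (p - true) = q)%N by rewrite /q /=; lia.
  transitivity (count (fun t => avoiding M t && (all (ltn z) s' || (head 0%N t < z)%N))
                  (permutations s'))%:Z.
    congr Posz; apply: eq_in_count => t; rewrite mem_permutations => ts.
    exact: avoiding_cons_below.
  (* For [i] = 0 the letter [z] is the smallest one and nothing is imposed; for [i > 0] the next
     letter must lie below [z], which is the second claim with [x = z] and [r = i]. *)
  rewrite /D; case: posnP => [i0 | i_gt0].
    rewrite -subn1 -eq -IHa; congr Posz; apply: eq_count => t.
    suff -> : all (ltn z) s' by rewrite andbT.
    apply/allP => y ys' /=; rewrite ltn_neqAle; apply/andP; split.
      by apply: contraNneq zs' => ->.
    rewrite leqNgt; apply/negP => yz.
    have : has (fun y => y < z)%N s' by apply/hasP; exists y.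
    by rewrite has_count cz i0.
  have := IHb z; rewrite cz eq subn1 => <- //; last exact: ltnW.
  congr Posz; apply: eq_count => t.
  suff /negbTE-> : ~~ all (ltn z) s' by [].
  rewrite -has_predC; have : has (fun y => y < z)%N s' by rewrite has_count cz.
  by apply: sub_has => y /=; rewrite -leqNgt => /ltnW.
have sumD r : (0 < r <= p)%N -> \sum_(i < r) D i = 'X^(p - r) * ('X + 1) ^+ r.-1.
  exact: sum_descent_poly.
have s_gt0 : (0 < size s)%N by rewrite sz.
split.
  rewrite count_permutations_cons // sz Posz_sum.
  rewrite (eq_bigr _ (fun (i : 'I_n.+1) _ => g i (ltn_ord i))).
  rewrite -linear_sum /=.
  rewrite -(big_mkord xpredT (fun i => if (i < p)%N then D i * P q else 'X^i * P (n - i))).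
  rewrite (big_cat_nat (n := p)) //= linearD /=.
  have -> : \sum_(0 <= i < p) (if (i < p)%N then D i * P q else 'X^i * P (n - i)) =
            \sum_(i < p) D i * P q.
    by rewrite big_mkord; apply: eq_bigr => i _; rewrite ltn_ord.
  have -> : \sum_(p <= i < n.+1) (if (i < p)%N then D i * P q else 'X^i * P (n - i)) =
            'X^p * (P q - deconv h q).
    rewrite -sum_deconv1 -[p in X in X = _]add0n big_addn big_mkord mulr_sumr.
    apply: eq_bigr => i _; rewrite ltnNge leq_addl /= mulrA -exprD addnC.
    by congr (_ * P _); rewrite /q; lia.
  (* It remains to cancel L(X^p Q_q) against the sum over letters below the maximum. For p = 0 that
     sum is empty and L(Q_q) = 0 since q > 0; for p > 0 the sum is (X + 1)^(p-1) Q_q(X + 1), and the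
     shift rule applies. *)
  rewrite mulrBr linearB /= addrC -addrA -[RHS]addr0; congr (_ + _).
  have [p0 | p_gt0] := posnP p.
    rewrite p0 big_ord0 linear0 addr0 mul1r bell_umbra_deconv0 // /q p0 /= oppr0 //.
  rewrite -mulr_suml sumD ?p_gt0 ?leqnn // subnn mul1r addrC.
  apply/eqP; rewrite subr_eq0; apply/eqP.
  rewrite -{2}(prednK p_gt0) exprS -mulrA bell_umbra_shift comp_polyM.
  by rewrite comp_Xn_poly.
move=> x le_xM r r_gt0.
have le_rp : (r <= p)%N by apply: sub_count => y /= /leq_trans; apply.
rewrite count_permutations_cons // sz.
(* A first letter of rank at least [r] is not below [x], so only the ranks [i < r] contribute. *)
rewrite (eq_bigr (fun i : 'I_n.+1 => if (i < r)%N then count (fun t => avoiding M (nth 0%N s i :: t))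
   (permutations (rem (nth 0%N s i) s)) else 0))%N; last first.
  move=> i _; rewrite -/r -(@nth_lt_count s x) ?sz //; case: ltnP => _.
    by apply: eq_count => t; rewrite andbT.
  by apply/eqP; rewrite -leqn0 leqNgt -has_count; apply/hasPn => t _; rewrite andbF.
rewrite -big_mkcond -(big_ord_widen n.+1 (fun i => count (fun t => avoiding M (nth 0%N s i :: t))
   (permutations (rem (nth 0%N s i) s)))) ?(leq_trans le_rp) // Posz_sum.
rewrite -sumD ?r_gt0 // mulr_suml linear_sum; apply: eq_bigr => i _.
have lt_ip := leq_trans (ltn_ord i) le_rp.
by rewrite g ?(leq_trans lt_ip) // lt_ip.
Qed.

Lemma count_avoiding_iota n : (count (avoiding 0) (permutations (iota 0 n)))%:Z = h n.
Proof.
have [-> _] := @count_avoiding n (iota 0 n) 0 (iota_ltn_sorted 0 n) (size_iota 0 n).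
rewrite (eq_count (a2 := pred0)) // count_pred0 subn0 mul1r bell_umbra_deconv1 //.
Qed.
End Count.

Theorem theorem4p7 (f : nat -> int)
  (f_def : forall m : nat,
     f m = (bell m)%:Z - \sum_(1 <= k < m.+1) f k.-1 * (bell (m - k)%N)%:Z)
  (n : nat) (n_ge1 : (1 <= n)%N) :
  (avoiders p21_2to3 n)%:Z = \sum_(0 <= k < n.+1) ('C(n, k))%:Z * f (n - k)%N.
Proof.
rewrite avoiders_count.
exact: (count_avoiding_iota (h := fun n => \sum_(0 <= k < n.+1) ('C(n, k))%:Z * f (n - k)%N)
          (conv_binomial_transform f_def)).
Qed.
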